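(* Let $\mathbb{K}$ be an algebraically closed field, let $n\geq 2$ be an integer, let $(d_1,\dots,d_n)\in\mathbb{Z}_{\ge 0}^n$ and $m_1,m_2\in\mathbb{Z}_{\ge 0}$, and let $\mathcal{L}=\mathcal{L}_{(d_1,\dots,d_n)}(m_1,m_2)$ be the linear system of hypersurfaces of multidegree $(d_1,\dots,d_n)$ in $(\mathbb{P}^1)^n$ having multiplicity at least $m_j$ at $q_j$ for $j=1,2$, where $q_1,q_2\in(\mathbb{P}^1)^n$ are two points in very general position. Then $\mathcal{L}$ is fiber non-special.
   Context: Let $V(\mathcal{L})$ be the $\mathbb{K}$-vector space of multihomogeneous polynomials in $\mathbb{K}[x_1,y_1,\dots,x_n,y_n]$ of multidegree $(d_1,\dots,d_n)$ (degree $d_i$ in the pair $x_i,y_i$) with multiplicity at least $m_j$ at $q_j$ for $j=1,2$ (no condition if $m_j=0$). Set $\dim(\mathcal{L})=\dim_{\mathbb{K}}V(\mathcal{L})-1$ (so the empty system has dimension $-1$). Distinct points $q_1,\dots,q_r\in(\mathbb{P}^1)^n$ are in very general position if, for every $d\in\mathbb{Z}_{\ge0}^n$ and $m\in\mathbb{Z}_{\ge0}^r$, the dimension of the space of multihomogeneous polynomials of multidegree $d$ with multiplicity at least $m_j$ at $q_j$ for all $j$ attains the minimal value among all $r$-tuples of distinct points of $(\mathbb{P}^1)^n$. (Here $r=2$.) For $I\subseteq\{1,\dots,n\}$ put $s_I=\sum_{i\in I}d_i$ and $S_I=1+|I|+s_I$ (so $s_\emptyset=0$, $S_\emptyset=1$).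 Fiber dimension and fiber-expected dimension (with $r=2$): $$\operatorname{fdim}(\mathcal{L})=\prod_{i=1}^n(d_i+1)-\sum_{\substack{1\le j\le r,\ I\subseteq\{1,\dots,n\}\\ S_I\le m_j}}(-1)^{|I|}\binom{m_j-S_I+n}{n}-1,\qquad \operatorname{efdim}(\mathcal{L})=\max(-1,\operatorname{fdim}(\mathcal{L})).$$ $\mathcal{L}$ is fiber special if $\dim(\mathcal{L})>\operatorname{efdim}(\mathcal{L})$, and fiber non-special otherwise. *)

(* Defs.v *)
From HB Require Import structures.
From mathcomp Require Import all_boot all_order all_algebra.
From mathcomp Require Import generic_quotient.
From mathcomp Require Import mpoly.

Set Implicit Arguments.
Unset Strict Implicit.
Unset Printing Implicit Defensive.

Import Order.TTheory GRing.Theory Num.Theory.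
Local Open Scope ring_scope.

Section ProjectiveLine.
Variable K : fieldType.

Definition hcoords : Type := {u : K * K | u != (0, 0)}.

Definition proportional : rel hcoords :=
  fun u v => (val u).1 * (val v).2 == (val u).2 * (val v).1.

Lemma proportionalP (u v : hcoords) :
  reflect (exists2 c : K, c != 0 & val u = (c * (val v).1, c * (val v).2))
          (proportional u v).
Proof.
rewrite /proportional; case: u v => [[a b] hu] [[a' b'] hv] /=.
apply: (iffP eqP) => [e | [c c0 [-> ->]]]; last by rewrite -!mulrA [b' * _]mulrC.
move: hu hv; rewrite !xpair_eqE !negb_and => hu hv.
have [a'0 | a'0] := eqVneq a' 0.
  move: hv; rewrite a'0 eqxx /= => b'0.
  have a0 : a = 0.
    by move/eqP: e; rewrite a'0 mulr0 mulf_eq0 (negPf b'0) orbF => /eqP.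
  move: hu; rewrite a0 eqxx /= => b0.
  by exists (b / b'); rewrite ?mulf_neq0 ?invr_eq0 // mulr0 divfK.
have eb : b = a / a' * b' by rewrite mulrAC e mulfK.
exists (a / a'); last by rewrite divfK // -eb.
rewrite mulf_neq0 ?invr_eq0 //; move: hu; rewrite eb.
by case: eqVneq => // ->; rewrite !mul0r eqxx.
Qed.

Lemma proportional_refl : reflexive proportional.
Proof. by move=> u; rewrite /proportional mulrC. Qed.

Lemma proportional_sym : ssrbool.symmetric proportional.
Proof.
by move=> u v; rewrite /proportional eq_sym mulrC [X in _ == X]mulrC.
Qed.

Lemma proportional_trans : transitive proportional.
Proof.
move=> v u w /proportionalP [c c0 eu] /proportionalP [c' c'0 ev].
apply/proportionalP; exists (c * c'); first exact: mulf_neq0.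
by rewrite eu ev /= !mulrA.
Qed.

Canonical proportional_equiv :=
  EquivRel proportional proportional_refl proportional_sym proportional_trans.

Definition P1 := {eq_quot proportional_equiv}%qT.

Lemma P1_piP (u v : hcoords) :
  reflect (exists2 c : K, c != 0 & val u = (c * (val v).1, c * (val v).2))
          (\pi_P1 u == \pi_P1 v)%qT.
Proof. by rewrite eqmodE; apply: proportionalP. Qed.

End ProjectiveLine.

Section Multihomogeneous.
Variables (K : fieldType) (n : nat).

(* In {mpoly K[n + n]} the variable x_i is 'X_(lshift n i) and y_i is
   'X_(rshift n i). *)
Definition has_multideg (d : 'I_n -> nat) : pred 'X_{1..n + n} :=
  fun a => [forall i, a (lshift n i) + a (rshift n i) == d i]%N.

Definition multihomog (d : 'I_n -> nat) : pred {mpoly K[n + n]} :=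
  fun p => all (has_multideg d) (msupp p).

Lemma multihomogP (d : 'I_n -> nat) (p : {mpoly K[n + n]}) :
  reflect (forall a, ~~ has_multideg d a -> p@_a = 0) (multihomog d p).
Proof.
apply: (iffP allP) => [h a | h a].
  by apply: contraNeq; rewrite -mcoeff_msupp => /h.
by rewrite mcoeff_msupp; apply: contraNT => /h ->.
Qed.

Variable d : 'I_n -> nat.

Lemma multihomog_submod_closed : submod_closed (multihomog d).
Proof.
split=> [|c p q /multihomogP hp /multihomogP hq]; apply/multihomogP => a ha.
  by rewrite mcoeff0.
by rewrite mcoeffD mcoeffZ hp // hq // mulr0 addr0.
Qed.

HB.instance Definition _ :=
  GRing.isSubmodClosed.Build K {mpoly K[n + n]} (multihomog d)
    multihomog_submod_closed.

Record mhpoly := MHPoly {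
  mpoly_of_mhpoly :> {mpoly K[n + n]};
  _ : mpoly_of_mhpoly \in multihomog d }.

HB.instance Definition _ := [isSub for mpoly_of_mhpoly].
HB.instance Definition _ := [Choice of mhpoly by <:].
HB.instance Definition _ := [SubChoice_isSubLmodule of mhpoly by <:].

Lemma mpoly_of_mhpoly_is_linear : linear mpoly_of_mhpoly.
Proof. by []. Qed.

HB.instance Definition _ :=
  GRing.isLinear.Build K mhpoly {mpoly K[n + n]} _ mpoly_of_mhpoly
    mpoly_of_mhpoly_is_linear.

(* The exponents (a_1, ..., a_n) with a_i <= d_i index the monomials
   \prod_i x_i^(a_i) y_i^(d_i - a_i) of multidegree d. *)
Definition mhexp := {dffun forall i : 'I_n, 'I_(d i).+1}.

Definition mhmon (e : mhexp) : 'X_{1..n + n} :=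
  [multinom match split k with inl i => e i | inr i => d i - e i end
     | k < n + n]%N.

Lemma mhmon_lshift (e : mhexp) i : mhmon e (lshift n i) = e i.
Proof. by rewrite mnmE (unsplitK (inl i)). Qed.

Lemma mhmon_rshift (e : mhexp) i : mhmon e (rshift n i) = (d i - e i)%N.
Proof. by rewrite mnmE (unsplitK (inr i)). Qed.

Lemma mhmon_multideg (e : mhexp) : has_multideg d (mhmon e).
Proof.
by apply/forallP => i; rewrite mhmon_lshift mhmon_rshift subnKC // -ltnS.
Qed.

Lemma mhmon_inj : injective mhmon.
Proof.
move=> e e' h; apply/ffunP => i; apply: val_inj.
by rewrite /= -!mhmon_lshift h.
Qed.

Lemma mhmon_surj a : has_multideg d a -> exists e, a = mhmon e.
Proof.
move=> /forallP ha; exists (finfun (fun i => inord (a (lshift n i)))).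
have le i : (a (lshift n i) < (d i).+1)%N.
  by rewrite ltnS -(eqP (ha i)) leq_addr.
apply/mnmP => k; case: (split_ordP k) => i ->.
  by rewrite mhmon_lshift ffunE inordK.
by rewrite mhmon_rshift ffunE inordK // -(eqP (ha i)) addKn.
Qed.

Lemma mhpoly_vecaxiom : Vector.axiom #|{: mhexp}| mhpoly.
Proof.
pose f (p : mhpoly) : 'rV[K]_#|{: mhexp}| :=
  \row_k (mpoly_of_mhpoly p)@_(mhmon (enum_val k)).
have fl : linear f.
  by move=> c p q; apply/rowP => k; rewrite !mxE /= mcoeffD mcoeffZ.
pose g0 (v : 'rV[K]_#|{: mhexp}|) : {mpoly K[n + n]} :=
  \sum_(k < #|{: mhexp}|) v 0 k *: 'X_[mhmon (enum_val k)].
have g0P v : g0 v \in multihomog d.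
  apply/multihomogP => a ha; rewrite raddf_sum big1 // => k _ /=.
  rewrite mcoeffZ mcoeffX; case: eqP => [ea|]; last by rewrite mulr0.
  by rewrite -ea mhmon_multideg in ha.
have g0E v k : (g0 v)@_(mhmon (enum_val k)) = v 0 k.
  rewrite raddf_sum (bigD1 k) //= mcoeffZ mcoeffX eqxx mulr1 big1 ?addr0 //.
  move=> l lk; rewrite mcoeffZ mcoeffX (inj_eq mhmon_inj) (inj_eq enum_val_inj).
  by rewrite (negPf lk) mulr0.
exists f => //; exists (fun v => MHPoly (g0P v)) => [p | v].
  apply: val_inj; apply/mpolyP => a /=.
  have [/mhmon_surj [e ->] | ha] := boolP (has_multideg d a).
    by rewrite -[e]enum_rankK g0E mxE.
  case: p => p hp /=.
  by rewrite (multihomogP _ _ hp) // (multihomogP _ _ (g0P _)).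
by apply/rowP => k; rewrite mxE /= g0E.
Qed.

HB.instance Definition _ := Lmodule_hasFinDim.Build K mhpoly mhpoly_vecaxiom.

End Multihomogeneous.

Section LinearSystems.
Variables (K : fieldType) (n : nat).

Definition P1n := {ffun 'I_n -> P1 K}.

(* Images of x_i and y_i in an affine chart centred at the point
   u = [a : b] of P^1, with local parameter t = 'X_i: if a <> 0 the chart is
   x_i = 1, y_i = b / a + t, otherwise u = [0 : 1] and the chart is
   x_i = t, y_i = 1. *)
Definition chart (u : P1 K) (i : 'I_n) : {mpoly K[n]} * {mpoly K[n]} :=
  let: (a, b) := val (repr u) in
  if a != 0 then (1, (b / a)%:MP + 'X_i) else ('X_i, 1).

Definition local_eq (q : P1n) (p : {mpoly K[n + n]}) : {mpoly K[n]} :=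
  p \mPo [tuple match split k with
                | inl i => (chart (q i) i).1
                | inr i => (chart (q i) i).2
                end | k < n + n].

(* The local equation at q lies in the m-th power of the maximal ideal
   ('X_0, ..., 'X_(n-1)); this makes sense in any characteristic. *)
Definition mult_ge (q : P1n) (m : nat) (p : {mpoly K[n + n]}) : Prop :=
  forall a : 'X_{1..n}, (mdeg a < m)%N -> (local_eq q p)@_a = 0.

Definition local_coef (d : 'I_n -> nat) (q : P1n) (a : 'X_{1..n})
  (p : mhpoly K d) : K^o := (local_eq q p)@_a.

Lemma local_coef_is_linear d q a : linear (@local_coef d q a).
Proof.
move=> c p p'.
by rewrite /local_coef /local_eq !linearP.
Qed.

HB.instance Definition _ d q a :=
  GRing.isLinear.Build K (mhpoly K d) K^o _ (@local_coef d q a)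
    (@local_coef_is_linear d q a).

(* V(L), as a subspace of the space of multihomogeneous polynomials of
   multidegree d; see lin_sysP. *)
Definition lin_sys (r : nat) (d : 'I_n -> nat) (q : 'I_r -> P1n)
    (m : 'I_r -> nat) : {vspace mhpoly K d} :=
  (\bigcap_(j < r) \bigcap_(a : 'X_{1..n < m j})
     lker (linfun (local_coef (d := d) (q j) a)))%VS.

Lemma lin_sysP r (d : 'I_n -> nat) (q : 'I_r -> P1n) m (p : mhpoly K d) :
  p \in lin_sys d q m <-> forall j, mult_ge (q j) (m j) p.
Proof.
rewrite memvE; split.
  move=> /subv_bigcapP h j a ha.
  have /subv_bigcapP /(_ (BMultinom ha) isT) := h j isT.
  by rewrite -memvE memv_ker lfunE /= => /eqP.
move=> h; apply/subv_bigcapP => j _; apply/subv_bigcapP => a _.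
by rewrite -memvE memv_ker lfunE /=; apply/eqP; apply: h; apply: bmdeg.
Qed.

Definition ls_dim (r : nat) (d : 'I_n -> nat) (q : 'I_r -> P1n)
    (m : 'I_r -> nat) : int :=
  (\dim (lin_sys d q m))%:Z - 1.

(* "q_1, ..., q_r are distinct" is injectivity of q. *)
Definition very_general (r : nat) (q : 'I_r -> P1n) : Prop :=
  injective q /\
  forall (d : 'I_n -> nat) (m : 'I_r -> nat) (q' : 'I_r -> P1n),
    injective q' -> (\dim (lin_sys d q m) <= \dim (lin_sys d q' m))%N.

End LinearSystems.

Section FiberDimension.
Variable n : nat.

Definition ssum (d : 'I_n -> nat) (I : {set 'I_n}) : nat := \sum_(i in I) d i.

Definition Ssum (d : 'I_n -> nat) (I : {set 'I_n}) : nat :=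
  (1 + #|I| + ssum d I)%N.

Definition fdim (r : nat) (d : 'I_n -> nat) (m : 'I_r -> nat) : int :=
  (\prod_(i < n) (d i + 1))%N%:Z
  - (\sum_(j < r) \sum_(I : {set 'I_n} | (Ssum d I <= m j)%N)
       (-1) ^+ #|I| * 'C(m j - Ssum d I + n, n)%:Z)
  - 1.

Definition efdim (r : nat) (d : 'I_n -> nat) (m : 'I_r -> nat) : int :=
  Num.max (-1) (fdim d m).

End FiberDimension.

Definition fiber_special (K : fieldType) (n r : nat) (d : 'I_n -> nat)
    (q : 'I_r -> P1n K n) (m : 'I_r -> nat) : Prop :=
  efdim d m < ls_dim d q m.

Definition fiber_nonspecial (K : fieldType) (n r : nat) (d : 'I_n -> nat)
    (q : 'I_r -> P1n K n) (m : 'I_r -> nat) : Prop :=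
  ~ fiber_special d q m.

(* Main.v *)
Require Import Defs.
From mathcomp Require Import all_boot all_order all_algebra.
From mathcomp Require Import generic_quotient mpoly.

(** The points in very general position minimise the dimension among all pairs
    of distinct points, so it suffices to exhibit one pair for which the
    dimension is at most the fiber-expected one.  Two opposite torus-fixed
    points of (P^1)^n do this: [1 : 0] in every factor and [0 : 1] in every
    factor.  In the standard charts centred there, the monomial
    x^e y^(d - e) becomes the local monomial t^(d - e), respectively t^e.
    The two multiplicity conditions therefore just kill coefficients, and the
    system is spanned by the monomials with |d - e| >= m_1 and |e| >= m_2
    ([dim_lin_sys_corner]).

    On the other side, the alternating sum attached to one point in the fiber
    dimension is the inclusion-exclusion count of the exponents of total
    degree < m inside the box [0, d_1] x ... x [0, d_n] ([card_box]): a subset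
    I records coordinates that overflow the box, and binomials count all
    multinomials of bounded degree.  Hence the fiber dimension plus one is the
    size of the box minus the numbers of exponents killed at the two points.

    As |e| + |d - e| = |d|, either m_1 + m_2 <= |d|, and no exponent is killed
    twice, so that the surviving monomials are as many as expected; or
    m_1 + m_2 > |d|, every exponent is killed and the system is empty. *)

Set Implicit Arguments.
Unset Strict Implicit.
Unset Printing Implicit Defensive.

Import Order.TTheory GRing.Theory Num.Theory.
Local Open Scope ring_scope.

(** * Counting exponents of bounded degree in a box *)

Lemma card_bmultinom n k : #|{: 'X_{1..n < k.+1}}| = 'C(k + n, n).
Proof.
rewrite addnC -card_partial_ord_partitions -cardsT.
pose f (a : 'X_{1..n < k.+1}) : n.-tuple 'I_k.+1 := [tuple inord (a i) | i < n].
have fE a i : tnth (f a) i = a i :> nat.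
  rewrite tnth_mktuple inordK // (leq_ltn_trans _ (bmdeg a)) //.
  by rewrite mdegE (bigD1 i) //= leq_addr.
have f_inj : injective f.
  move=> a b eab; apply/val_inj/mnmP => i.
  by rewrite -!fE eab.
rewrite -(card_imset _ f_inj); apply: eq_card => t; rewrite inE big_tuple.
apply/imsetP/idP => [[a _ ->]|ht].
  under eq_bigr => i _ do rewrite fE.
  by rewrite -mdegE -ltnS bmdeg.
have ha : (mdeg [multinom (tnth t i : nat) | i < n] < k.+1)%N.
  by rewrite mdegE ltnS; under eq_bigr => i _ do rewrite mnmE.
exists (BMultinom ha) => //; apply/eq_from_tnth => i; apply: val_inj.
by rewrite /= fE mnmE.
Qed.

(** Subtracting u identifies the multinomials above u with all multinomials
    of correspondingly smaller degree. *)
Lemma card_bmultinom_ge n m (u : 'X_{1..n}) :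
  #|[set a : 'X_{1..n < m} | (u <= a)%MM]| =
  if (mdeg u < m)%N then 'C(m - (mdeg u).+1 + n, n) else 0%N.
Proof.
have [lt_um | le_mu] := ltnP (mdeg u) m; last first.
  apply/eqP; rewrite cards_eq0; apply/eqP/setP => a; rewrite !inE.
  apply/negP => le_ua; have := bmdeg a.
  by rewrite ltnNge (leq_trans le_mu) // -(submK le_ua) mdegD leq_addl.
rewrite -card_bmultinom -cardsT.
have fP (a : 'X_{1..n < (m - (mdeg u).+1).+1}) : (mdeg (a + u)%MM < m)%N.
  by rewrite mdegD addnC -ltn_subRL (leq_trans (bmdeg a)) // subnSK.
pose f a := BMultinom (fP a).
have f_inj : injective f.
  by move=> a b /(congr1 val) /= /addIm /val_inj.
rewrite -(card_imset _ f_inj); apply: eq_card => a; rewrite inE.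
apply/idP/imsetP => [le_ua | [b _ ->]]; last exact: lem_addl.
have hb : (mdeg (a - u)%MM < (m - (mdeg u).+1).+1)%N.
  by rewrite subnSK // ltn_subRL addnC -mdegD submK // bmdeg.
by exists (BMultinom hb) => //; apply: val_inj; rewrite /= submK.
Qed.

(** Inclusion-exclusion: the sum over I expands the product over i of
    1 - [d i < a i], and asking d i < a i for the i in I means that a dominates
    the multinomial with entries d i + 1 on I, whose degree is Ssum d I - 1. *)
Lemma card_box n m (d : 'I_n -> nat) :
  #|[set a : 'X_{1..n < m} | [forall i, a i <= d i]%N]|%:Z =
  \sum_(I : {set 'I_n} | (Ssum d I <= m)%N)
     (-1) ^+ #|I| * 'C(m - Ssum d I + n, n)%:Z.
Proof.
pose u (I : {set 'I_n}) := [multinom ((i \in I) * (d i).+1)%N | i < n].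
have deg_u I : Ssum d I = (mdeg (u I)).+1.
  rewrite mdegE /Ssum /ssum -addnA add1n -sum1_card -big_split /= big_mkcond.
  congr _.+1; apply: eq_bigr => i _.
  by rewrite mnmE; case: (i \in I); rewrite ?mul1n ?mul0n.
have indicator (a : 'X_{1..n}) :
    [forall i, a i <= d i]%N%:Z =
    \sum_(I : {set 'I_n}) (-1) ^+ #|I| * (u I <= a)%MM%:Z.
  transitivity (\prod_i (- (d i < a i)%N%:Z + 1)).
    have [/forallP h | ] := boolP [forall i, a i <= d i]%N.
      by rewrite big1 // => i _; rewrite ltnNge h.
    rewrite negb_forall => /existsP [i]; rewrite -ltnNge => h.
    by rewrite (bigD1 i) //= h mul0r.
  rewrite bigA_distr; apply: eq_big => [I | I _]; first by rewrite inE.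
  rewrite -big_mkcond prodrN; congr (_ * _).
  have [/mnm_lepP h | h] := boolP (u I <= a)%MM.
    by rewrite big1 // => i iI; have := h i; rewrite mnmE iI mul1n => ->.
  have /forallPn [i] : ~~ [forall i, u I i <= a i]%N.
    by apply: contra h => /forallP h; apply/mnm_lepP.
  rewrite mnmE; case: (boolP (i \in I)) => [iI | _]; last by rewrite mul0n.
  by rewrite mul1n => /negPf h'; rewrite (bigD1 i) //= h' mul0r.
transitivity (\sum_(a : 'X_{1..n < m}) [forall i, a i <= d i]%N%:Z).
  rewrite -sum1dep_card -natz natr_sum big_mkcond /=.
  by apply: eq_bigr => a _; case: [forall i, _].
under eq_bigr => a _ do rewrite indicator.
rewrite exchange_big [RHS]big_mkcond /=; apply: eq_bigr => I _.
rewrite -mulr_sumr.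
have -> : \sum_(a : 'X_{1..n < m}) (u I <= a)%MM%:Z =
          #|[set a : 'X_{1..n < m} | (u I <= a)%MM]|%:Z.
  rewrite -sum1dep_card -[RHS]natz natr_sum [RHS]big_mkcond /=.
  by apply: eq_bigr => a _; case: (_ <= _)%MM.
by rewrite card_bmultinom_ge deg_u; case: ifP => //; rewrite mulr0.
Qed.

(** * Multiplicity conditions at the two torus-fixed points *)

Section Corners.
Variables (K : fieldType) (n : nat).

(** The torus-fixed point [0 : 1] if b, and [1 : 0] otherwise. *)
Definition axis_coords (b : bool) : K * K := if b then (0, 1) else (1, 0).

Lemma axis_coords_neq0 b : axis_coords b != (0, 0).
Proof. by case: b; rewrite xpair_eqE oner_eq0 ?andbF. Qed.

Definition axis_point (b : bool) : P1 K :=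
  (\pi_(P1 K) (exist _ (axis_coords b) (axis_coords_neq0 b) : hcoords K))%qT.

Definition corner (b : bool) : P1n K n := [ffun => axis_point b].

Lemma chart_axis_point b i :
  chart (n := n) (axis_point b) i = if b then ('X_i, 1) else (1, 'X_i).
Proof.
rewrite /chart.
have /P1_piP [c c0 ->] :
    (\pi_(P1 K) (repr (axis_point b)) ==
     \pi_(P1 K) (exist _ (axis_coords b) (axis_coords_neq0 b) : hcoords K))%qT.
  by rewrite reprK.
by case: b; rewrite /= ?mulr0 ?mulr1 ?eqxx // c0 mul0r mpolyC0 add0r.
Qed.

Lemma axis_point_inj : injective axis_point.
Proof.
have neq : axis_point true != axis_point false.
  apply/P1_piP => - [c _ /= [/esym /eqP]].
  by rewrite mulr1 => /eqP -> /eqP; rewrite mul0r oner_eq0.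
by case=> -[] // e; move: neq; rewrite e eqxx.
Qed.

Lemma corner_inj : (0 < n)%N -> injective corner.
Proof.
move=> n_gt0 b b' /ffunP /(_ (Ordinal n_gt0)); rewrite !ffunE.
exact: axis_point_inj.
Qed.

Variable d : 'I_n -> nat.

(** The exponent of the local equation of x^e y^(d - e) at a corner. *)
Definition corner_exp (b : bool) (e : mhexp d) : 'X_{1..n} :=
  [multinom if b then e i : nat else (d i - e i)%N | i < n].

Lemma corner_exp_inj b : injective (corner_exp b).
Proof.
move=> e e' /mnmP h; apply/ffunP => i; apply: val_inj => /=.
have := h i; rewrite !mnmE; case: b {h} => //.
have le_ed (e0 : mhexp d) : (e0 i <= d i)%N by rewrite -ltnS.
by move=> h; rewrite -[LHS](subKn (le_ed e)) h subKn.
Qed.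

Lemma mdeg_corner_exp e :
  (mdeg (corner_exp true e) + mdeg (corner_exp false e))%N = (\sum_i d i)%N.
Proof.
rewrite !mdegE -big_split; apply: eq_bigr => i _ /=.
by rewrite !mnmE subnKC // -ltnS.
Qed.

Lemma local_eq_mhmon b (e : mhexp d) :
  local_eq (corner b) ('X_[mhmon e] : {mpoly K[n + n]}) = 'X_[corner_exp b e].
Proof.
rewrite /local_eq comp_mpolyX big_split_ord /= -big_split mpolyXE_id /=.
apply: eq_bigr => i _; rewrite !tnth_mktuple mhmon_lshift mhmon_rshift mnmE.
rewrite (unsplitK (inl i)) (unsplitK (inr i)) !ffunE chart_axis_point.
by case: b; rewrite /= expr1n ?mulr1 ?mul1r.
Qed.

Lemma mhmon_multihomog (e : mhexp d) :
  ('X_[mhmon e] : {mpoly K[n + n]}) \in multihomog d.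
Proof.
apply/multihomogP => a ha; rewrite mcoeffX; case: eqP => // ea.
by rewrite -ea mhmon_multideg in ha.
Qed.

Definition monom (e : mhexp d) : mhpoly K d := MHPoly (mhmon_multihomog e).

Lemma mhpolyE (p : mhpoly K d) : p = \sum_e p@_(mhmon e) *: monom e.
Proof.
apply: val_inj; rewrite raddf_sum /=; apply/mpolyP => a.
rewrite raddf_sum /=.
have [/mhmon_surj [e ->] | ha] := boolP (has_multideg d a).
  rewrite (bigD1 e) //= mcoeffZ mcoeffX eqxx mulr1 big1 ?addr0 // => e' ne.
  by rewrite mcoeffZ mcoeffX (inj_eq (@mhmon_inj _ d)) (negPf ne) mulr0.
rewrite (multihomogP _ _ (valP p)) // big1 // => e _.
by rewrite mcoeffZ (multihomogP _ _ (mhmon_multihomog e)) // mulr0.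
Qed.

Lemma local_coef_corner b e (p : mhpoly K d) :
  local_coef (corner b) (corner_exp b e) p = p@_(mhmon e).
Proof.
rewrite {1}[p]mhpolyE linear_sum (bigD1 e) //= linearZ /= big1 ?addr0.
  by rewrite /local_coef local_eq_mhmon mcoeffX eqxx; exact: mulr1.
move=> e' ne; rewrite linearZ /= /local_coef local_eq_mhmon mcoeffX.
by rewrite (inj_eq (@corner_exp_inj b)) (negPf ne) scaler0.
Qed.

Definition killed (b : bool) (m : nat) : {set mhexp d} :=
  [set e | (mdeg (corner_exp b e) < m)%N].

(** A multiplicity condition at a corner asks exactly that the coefficients at
    killed exponents vanish, so the other monomials span the system. *)
Lemma dim_lin_sys_corner r (b : 'I_r -> bool) (m : 'I_r -> nat) :
  (\dim (lin_sys d (fun j => corner (b j)) m) <=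
   #|~: \bigcup_j killed (b j) (m j)|)%N.
Proof.
set A := ~: _.
apply: (@leq_trans (\dim <<[seq monom e | e in A]>>%VS)); last first.
  by apply: leq_trans (dim_span _) _; rewrite size_image.
apply: dimvS; apply/subvP => p /lin_sysP hp; rewrite [p]mhpolyE.
apply: rpred_sum => e _; have [eA | ] := boolP (e \in A).
  by apply/memvZ/memv_span/image_f.
rewrite inE negbK => /bigcupP [j _]; rewrite inE => lt_m.
by rewrite -(local_coef_corner (b j)) /local_coef hp // scale0r mem0v.
Qed.

(** Both corners kill equally many exponents: e and d - e run through the same
    box, and clipping a multinomial to the box inverts [corner_exp]. *)
Lemma card_killed b m :
  #|killed b m| = #|[set a : 'X_{1..n < m} | [forall i, a i <= d i]%N]|.
Proof.
pose g (a : 'X_{1..n}) : mhexp d :=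
  [ffun i => inord (if b then a i else (d i - a i)%N)].
have gK (a : 'X_{1..n}) : [forall i, a i <= d i]%N -> corner_exp b (g a) = a.
  move=> /forallP h; apply/mnmP => i; rewrite mnmE ffunE.
  case: b @g => g; rewrite inordK ?ltnS ?h ?leq_subr //.
  by rewrite subKn.
have g_inj : {in [set a : 'X_{1..n < m} | [forall i, a i <= d i]%N] &,
                injective (fun a : 'X_{1..n < m} => g a)}.
  move=> a a'; rewrite !inE => ha ha' e; apply: val_inj => /=.
  by rewrite -(gK a ha) e gK.
rewrite -(card_in_imset g_inj); apply: eq_card => e; rewrite inE.
apply/idP/imsetP => [lt_m | [a]]; last first.
  by rewrite inE => /gK h ->; rewrite h bmdeg.
have he : [forall i, corner_exp b e i <= d i]%N.
  apply/forallP => i; rewrite mnmE; case: b {g gK g_inj lt_m}.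
    by rewrite -ltnS.
  exact: leq_subr.
exists (BMultinom lt_m); first by rewrite inE.
by apply: (@corner_exp_inj b); rewrite gK.
Qed.

Lemma card_mhexp : #|{: mhexp d}| = (\prod_(i < n) (d i + 1))%N.
Proof.
rewrite card_dep_ffun foldrE big_map big_enum.
by apply: eq_bigr => i _; rewrite card_ord addn1.
Qed.

Lemma fdim_killed r (b : 'I_r -> bool) (m : 'I_r -> nat) :
  fdim d m = #|{: mhexp d}|%:Z - \sum_j #|killed (b j) (m j)|%:Z - 1.
Proof.
rewrite /fdim card_mhexp; congr (_ - _ - _); apply: eq_bigr => j _.
by rewrite card_killed card_box.
Qed.

End Corners.

(** * Comparison with the fiber-expected dimension *)

Theorem theorem3p4 (K : closedFieldType) (n : nat) (hn : (2 <= n)%N)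
    (d : 'I_n -> nat) (m : 'I_2 -> nat) (q : 'I_2 -> P1n K n)
    (hq : very_general q) :
  fiber_nonspecial d q m.
Proof.
pose b (j : 'I_2) : bool := j != ord0.
have b_inj : injective b.
  by move=> [[|[|//]] ?] [[|[|//]] ?] //= _; apply: val_inj.
have q'_inj : injective (fun j => corner K n (b j)).
  by move=> i j /(corner_inj (ltnW hn)) /b_inj.
have := leq_trans (hq.2 d m _ q'_inj) (dim_lin_sys_corner K d b m).
rewrite /fiber_nonspecial /fiber_special /efdim /ls_dim => le_dim.
apply/negP; rewrite -leNgt le_max (fdim_killed d b) lerD2r.
move: le_dim; rewrite !big_ord_recl !big_ord0 setU0 addr0 /=.
set B0 := killed _ _ _; set B1 := killed _ _ _ => le_dim.
have [le_md | lt_dm] := leqP (m ord0 + m (lift ord0 ord0)) (\sum_i d i).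
  apply/orP; right.
  have disj : [disjoint B0 & B1].
    apply/pred0P => e; rewrite /= !inE; apply/negbTE/negP => /andP [h0 h1].
    have := leq_trans le_md (eq_leq (esym (mdeg_corner_exp e))).
    by rewrite leqNgt addnC -addSn leq_add // ltnW.
  have := cardsC (B0 :|: B1); rewrite cardsU.
  rewrite (eqP (_ : B0 :&: B1 == set0)) ?setI_eq0 // cards0 subn0 => cardE.
  by rewrite lerBrDr -PoszD -PoszD lez_nat -cardE addnC leq_add2l.
apply/orP; left.
have B_full : ~: (B0 :|: B1) = set0.
  apply/setP => e; rewrite !inE; apply/negbTE; rewrite negbK -implyNb -leqNgt.
  apply/implyP => h0; rewrite ltnNge; apply/negP => h1.
  move: lt_dm; rewrite ltnNge -(mdeg_corner_exp e) addnC.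
  by rewrite leq_add.
by move: le_dim; rewrite B_full cards0 leqn0 => /eqP ->.
Qed.
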